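(* Let $n\ge 1$. If $A,B\in\mathcal{M}_n$ are in additive finite free position, then the moments of $A+B$ can be expressed in terms of the moments of $A$ and the moments of $B$; that is, for every $r\ge 1$ there is a function $F_r$, depending only on $n$ and $r$, such that for all $A,B\in\mathcal{M}_n$ in additive finite free position, $m_r(A+B)=F_r\big((m_k(A))_{k\ge1},(m_k(B))_{k\ge1}\big)$.
   Context: $\mathcal{M}_n=\mathbb{C}^{n\times n}$ and $\chi_A(x)=\det(xI-A)$. For $k\ge1$ the $k$-th moment of $A\in\mathcal{M}_n$ is $m_k(A)=\frac1n\mathrm{Tr}(A^k)$. For polynomials $p(x)=\sum_{k=0}^n a_kx^{n-k}$ and $q(x)=\sum_{k=0}^n b_kx^{n-k}$ of degree $n$ over $\mathbb{C}$, the additive convolution is $p(x)\boxplus q(x)=\sum_{k=0}^n\Big(\sum_{i+j=k}\frac{\binom{n-i}{j}}{\binom{n}{j}}a_ib_j\Big)x^{n-k}$. Matrices $A,B\in\mathcal{M}_n$ are in additive finite free position if $\chi_{A+B}(x)=\chi_A(x)\boxplus\chi_B(x)$. *)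

(* Defs.v *)
From HB Require Import structures.
From mathcomp Require Import all_boot all_order all_algebra.
From mathcomp Require Import reals.
From mathcomp Require Import complex.

Set Implicit Arguments.
Unset Strict Implicit.
Unset Printing Implicit Defensive.

Import GRing.Theory.
Local Open Scope ring_scope.

Section Defs.
Variables (C : numFieldType) (n : nat).

Definition moment (A : 'M[C]_n) (k : nat) : C := n%:R^-1 * \tr (A ^+ k).

(* The sequence (m_k(A))_{k >= 1}: the entry of index [k] is m_{k+1}(A). *)
Definition moments (A : 'M[C]_n) : nat -> C := fun k => moment A k.+1.

(* The coefficients are indexed by codegree, as in
   p = \sum_(k <= n) a_k 'X^(n - k), so a_k is p`_(n - k).  The degree [n] is a
   parameter of the operation, which is meant for p and q of degree n. *)
Definition add_conv (p q : {poly C}) : {poly C} :=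
  \sum_(k < n.+1)
    (\sum_(i < n.+1) \sum_(j < n.+1 | (i + j == k)%N)
       'C(n - i, j)%:R / 'C(n, j)%:R * p`_(n - i) * q`_(n - j)) *: 'X^(n - k).

Definition add_finite_free_position (A B : 'M[C]_n) : Prop :=
  char_poly (A + B) = add_conv (char_poly A) (char_poly B).

End Defs.

Arguments add_conv {C} n p q.

(* Main.v *)
Require Import Defs.
From mathcomp Require Import all_boot all_order all_algebra.
From mathcomp Require Import boolp reals.
From mathcomp Require Import complex.

Set Implicit Arguments.
Unset Strict Implicit.
Unset Printing Implicit Defensive.

Import GRing.Theory Num.Theory.
Local Open Scope ring_scope.
Local Open Scope complex_scope.

(** The moments of a complex matrix and its characteristic polynomial carry the
    same information, namely the multiset of eigenvalues.  Triangularizing [A]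
    (Schur) gives a list [s] of eigenvalues with [char_poly A] the product of
    the ['X - x], [x] in [s], and [\tr (A ^+ k)] the [k]-th power sum of [s]
    (lemma [eigenvalue_seq]).  The polynomial determines [s] up to permutation
    by unique factorization, hence determines the moments.  Conversely the power
    sums determine [s] up to permutation ([perm_eq_power_sums]): by linearity
    they determine the sum of [f] over [s] for every polynomial [f], and an [f]
    vanishing at every eigenvalue but one isolates the multiplicity of that one.

    In free position, the moments of [A] and [B] therefore determine
    [char_poly A] and [char_poly B], hence their additive convolution
    [char_poly (A + B)], hence the moments of [A + B].  The choice principle
    ([factors_through]) turns this dependence into a function [F]. *)

Section TriangularPowers.
Variables (R : comNzRingType) (n : nat).
Implicit Types T : 'M[R]_n.

Lemma trig_mx1 : is_trig_mx (1 : 'M[R]_n).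
Proof.
by apply/is_trig_mxP => i j lij; rewrite !mxE -val_eqE /= ltn_eqF.
Qed.

Lemma trig_mxM T1 T2 : is_trig_mx T1 -> is_trig_mx T2 -> is_trig_mx (T1 * T2).
Proof.
move=> /is_trig_mxP h1 /is_trig_mxP h2; apply/is_trig_mxP => i j lij.
rewrite mxE big1 // => k _; case: (ltnP i k) => [lik|lki].
  by rewrite h1 ?mul0r.
by rewrite h2 ?mulr0 // (leq_ltn_trans lki).
Qed.

Lemma trig_mxM_diag T1 T2 (i : 'I_n) : is_trig_mx T1 -> is_trig_mx T2 ->
  (T1 * T2) i i = T1 i i * T2 i i.
Proof.
move=> /is_trig_mxP h1 /is_trig_mxP h2.
rewrite mxE (bigD1 i) //= big1 ?addr0 // => k.
rewrite -val_eqE neq_ltn => /orP[lki|lik].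
  by rewrite h2 ?mulr0.
by rewrite h1 ?mul0r.
Qed.

Lemma trig_mxX T k : is_trig_mx T -> is_trig_mx (T ^+ k).
Proof.
by move=> hT; elim: k => [|k IHk]; rewrite ?expr0 ?trig_mx1 // exprS trig_mxM.
Qed.

Lemma mxtrace_trigX T k : is_trig_mx T -> \tr (T ^+ k) = \sum_i T i i ^+ k.
Proof.
move=> hT; apply: eq_bigr => i _.
elim: k => [|k IHk]; first by rewrite !expr0 mxE eqxx.
by rewrite !exprS trig_mxM_diag ?trig_mxX // IHk.
Qed.

End TriangularPowers.

Section Similarity.
Variables (R : comUnitRingType) (n : nat) (P A : 'M[R]_n).
Hypothesis P_unit : P \in unitmx.

Lemma char_poly_similar : char_poly (P *m A *m invmx P) = char_poly A.
Proof.
pose liftP : 'M[{poly R}]_n := map_mx polyC P.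
pose liftV : 'M[{poly R}]_n := map_mx polyC (invmx P).
have liftPV : liftP *m liftV = 1%:M by rewrite -map_mxM mulmxV // map_mx1.
rewrite /char_poly /char_poly_mx.
have -> : 'X%:M - map_mx polyC (P *m A *m invmx P)
        = liftP *m ('X%:M - map_mx polyC A) *m liftV.
  by rewrite mulmxBr mulmxBl scalar_mxC -!mulmxA liftPV mulmx1 !map_mxM.
by rewrite !det_mulmx mulrAC -det_mulmx liftPV det1 mul1r.
Qed.

Lemma mxtraceX_similar k : \tr ((P *m A *m invmx P) ^+ k) = \tr (A ^+ k).
Proof.
have -> : (P *m A *m invmx P) ^+ k = P *m (A ^+ k) *m invmx P.
  elim: k => [|k IHk]; first by rewrite !expr0 mulmx1 mulmxV.
  by rewrite !exprS IHk -!mulmxE !mulmxA mulmxKV.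
by rewrite mxtrace_mulC mulmxA mulVmx // mul1mx.
Qed.

End Similarity.

(** The list is the diagonal of a Schur form of [A]: both sides are invariant
    under similarity, and for a triangular matrix both are read off the
    diagonal. *)
Lemma eigenvalue_seq (C : numClosedFieldType) (n : nat) (A : 'M[C]_n) :
  (0 < n)%N ->
  exists2 s : seq C, char_poly A = \prod_(x <- s) ('X - x%:P)
    & forall k, \tr (A ^+ k) = \sum_(x <- s) x ^+ k.
Proof.
move=> n_gt0; have [P /unitarymx_unit P_unit] := Schur A n_gt0.
rewrite /similar_to conjumx // => trigA; set T := _ *m _ in trigA.
exists [seq T i i | i : 'I_n] => [|k].
  by rewrite -(char_poly_similar A P_unit) char_poly_trig // big_image.
by rewrite -(mxtraceX_similar A P_unit) mxtrace_trigX // big_image.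
Qed.

Section PowerSums.
Variable K : numFieldType.
Implicit Types s t : seq K.

Lemma eq_sum_horner s t :
  (forall k, \sum_(x <- s) x ^+ k = \sum_(x <- t) x ^+ k) ->
  forall f : {poly K}, \sum_(x <- s) f.[x] = \sum_(x <- t) f.[x].
Proof.
move=> eq_st f.
under eq_bigr do rewrite horner_coef.
under [RHS]eq_bigr do rewrite horner_coef.
rewrite exchange_big [RHS]exchange_big; apply: eq_bigr => k _.
by rewrite -!mulr_sumr eq_st.
Qed.

(** Testing equality of power sums against a polynomial that vanishes at all
    entries but [a] gives [f.[a] *+ count_mem a s = f.[a] *+ count_mem a t].
    Dividing by [f.[a]] needs characteristic zero: over a field of
    characteristic [p], a list of [p] equal entries has the same power sums as
    the empty list. *)
Lemma perm_eq_power_sums s t :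
  (forall k, \sum_(x <- s) x ^+ k = \sum_(x <- t) x ^+ k) -> perm_eq s t.
Proof.
move=> /eq_sum_horner eq_st; apply/allP => a _ /=; apply/eqP.
(* An unnormalized Lagrange polynomial: among the entries of [s] and [t], it is
   nonzero at [a] only. *)
pose f : {poly K} := \prod_(x <- s ++ t | x != a) ('X - x%:P).
have f_neq0 : f.[a] != 0.
  rewrite horner_prod prodf_seq_neq0; apply/allP => x _; apply/implyP => ne_xa.
  by rewrite hornerXsubC subr_eq0 eq_sym.
have f_eq0 x : x \in s ++ t -> x != a -> f.[x] = 0.
  move=> x_st ne_xa; rewrite horner_prod; apply/eqP.
  rewrite prodf_seq_eq0; apply/hasP; exists x => //.
  by rewrite ne_xa hornerXsubC subrr eqxx.
have sum_f u : {subset u <= s ++ t} ->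
    \sum_(x <- u) f.[x] = f.[a] *+ count_mem a u.
  move=> sub_u; rewrite (bigID (pred1 a)) /= [X in _ + X]big1_seq ?addr0.
    rewrite (eq_bigr (fun=> f.[a])) => [|x /eqP-> //].
    by rewrite big_const_seq iter_addr_0.
  by move=> x /andP[ne_xa /sub_u x_st]; apply: f_eq0.
have := eq_st f; rewrite !sum_f => [| x xt | x xs].
- by move/(mulrIn f_neq0).
- by rewrite mem_cat xt orbT.
- by rewrite mem_cat xs.
Qed.

End PowerSums.

Section MomentsAndCharPoly.
Variables (C : numClosedFieldType) (n : nat).
Hypothesis n_gt0 : (0 < n)%N.
Implicit Types A B : 'M[C]_n.

Lemma char_poly_eq_moment A B k :
  char_poly A = char_poly B -> moment A k = moment B k.
Proof.
have [s charA trA] := eigenvalue_seq A n_gt0.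
have [t charB trB] := eigenvalue_seq B n_gt0.
rewrite charA charB => /prod_XsubC_eq perm_st.
by rewrite /moment trA trB (perm_big _ perm_st).
Qed.

Lemma moments_eq_char_poly A B :
  moments A = moments B -> char_poly A = char_poly B.
Proof.
move=> eqAB.
have [s charA trA] := eigenvalue_seq A n_gt0.
have [t charB trB] := eigenvalue_seq B n_gt0.
rewrite charA charB; apply/perm_big/perm_eq_power_sums => k.
(* The moment of order [0] is not listed, but that trace is [n] for both. *)
rewrite -trA -trB; case: k => [|k]; first by rewrite !expr0.
have n_neq0 : (n%:R^-1 : C) != 0 by rewrite invr_eq0 pnatr_eq0 -lt0n.
by apply: (mulfI n_neq0); apply: (congr1 (@^~ k) eqAB).
Qed.

End MomentsAndCharPoly.

Lemma factors_through (X Y Z : Type) (z0 : Z) (P : X -> Prop)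
    (h : X -> Y) (g : X -> Z) :
  (forall x x', P x -> P x' -> h x = h x' -> g x = g x') ->
  exists F : Y -> Z, forall x, P x -> g x = F (h x).
Proof.
move=> g_h.
have /choice[F FP] : forall y, exists z, forall x, P x -> h x = y -> g x = z.
  move=> y; have [[x0 [Px0 <-]]|no_x] := pselect (exists x, P x /\ h x = y).
    by exists (g x0) => x Px; apply: g_h.
  by exists z0 => x Px hx; case: no_x; exists x.
by exists F => x Px; apply: FP.
Qed.

Lemma moment_add_free (C : numClosedFieldType) (n r : nat) : (0 < n)%N ->
  exists F : (nat -> C) -> (nat -> C) -> C,
    forall A B : 'M[C]_n,
      add_finite_free_position A B ->
      moment (A + B) r = F (moments A) (moments B).
Proof.
move=> n_gt0.
pose free (AB : 'M[C]_n * 'M[C]_n) := add_finite_free_position AB.1 AB.2.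
pose in_moments (AB : 'M[C]_n * 'M[C]_n) := (moments AB.1, moments AB.2).
pose out_moment (AB : 'M[C]_n * 'M[C]_n) := moment (AB.1 + AB.2) r.
have [|F FP] := @factors_through _ _ _ 0 free in_moments out_moment.
  move=> [A B] [A' B'] freeAB freeAB' [eqA eqB].
  apply: char_poly_eq_moment => //.
  rewrite freeAB freeAB' /=.
  by rewrite (moments_eq_char_poly n_gt0 eqA) (moments_eq_char_poly n_gt0 eqB).
by exists (fun a b => F (a, b)) => A B freeAB; apply: (FP (A, B)).
Qed.

Theorem theorem5p1 (R : realType) (n : nat) (hn : (1 <= n)%N)
    (r : nat) (hr : (1 <= r)%N) :
  exists F : (nat -> R[i]) -> (nat -> R[i]) -> R[i],
    forall A B : 'M[R[i]]_n,
      add_finite_free_position A B ->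
      moment (A + B) r = F (moments A) (moments B).
Proof.
exact: (@moment_add_free R[i]).
Qed.
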